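(* Let $N,j\ge 1$ and $0\le t<N$ be integers with $j<N-t$. Then $$\left|S^{\bullet}(N,N-t,j)\right|=\sum_{i_0=\max\{1,j-t\}}^{j} C_{N-t-i_0}\,\frac{(j-i_0+1)^2}{j(t+1)}\binom{i_0+2t-j}{t}\binom{i_0+j-2}{j-1}.$$
   Context: $S_N$ is the set of permutations $\sigma=\sigma_1\ldots\sigma_N$ of $1,\dots,N$. A permutation $\sigma$ avoids $312$ if there are no indices $i_1<i_2<i_3$ with $\sigma_{i_1}>\sigma_{i_3}>\sigma_{i_2}$; $S_N(312)$ is the set of $312$-avoiding permutations in $S_N$. For integers $i,j\in[1,N]$, $S^{\bullet}(N,i,j)=\{\sigma\in S_N(312):\sigma_i=j\}$. $C_n=\frac{1}{n+1}\binom{2n}{n}$ for $n\ge 0$ is the Catalan number. *)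

(* Defs.v *)
From mathcomp Require Import all_boot all_order all_algebra all_fingroup.
Set Implicit Arguments. Unset Strict Implicit. Unset Printing Implicit Defensive.
Import GRing.Theory.
Local Open Scope ring_scope.

Definition avoids312 (N : nat) (s : {perm 'I_N}) : bool :=
  ~~ [exists i1 : 'I_N, exists i2 : 'I_N, exists i3 : 'I_N,
       [&& (i1 < i2)%N, (i2 < i3)%N, (s i3 < s i1)%N & (s i2 < s i3)%N]].

(* Positions i and values j are 1-based while 'I_N is 0-based, hence the
   successors.  For i or j outside [1, N] the set is empty. *)
Definition Sbullet (N i j : nat) : {set {perm 'I_N}} :=
  [set s : {perm 'I_N} | avoids312 s &
     [exists k : 'I_N, (k.+1 == i)%N && ((s k).+1 == j)%N]].

Definition catalan (n : nat) : rat := (n.+1)%:R^-1 * ('C(2 * n, n))%:R.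

(* Main.v *)
Require Import Defs.
From mathcomp Require Import all_boot all_order all_algebra all_fingroup.
From mathcomp Require Import zify ring.
Import GRing.Theory.
Local Open Scope ring_scope.

(** The count rests on building permutations from right to left.  Removing the
    first entry [k] of a permutation and standardizing the rest gives a
    permutation [s]; the permutation avoids 312 iff [s] does and
    [k <= s 0 + 1] ([avoids312_lift_perm], values counted from 0).  So only the
    first entry matters for further extension, and a 312-avoiding permutation
    of size [N] amounts to a word [c_1 ... c_N] with [c_N = 0] and
    [c_i <= c_(i+1) + 1] (its Lehmer code).

    Fix a position followed by [t] entries, and let [s] be the letter of the
    word there, that is, the number of later smaller entries.
    - The suffix is a word of length [t + 1] starting with [s]; there are
      [ballot (t - s) s] of these ([sum_first_entry]).
    - Going left, the entries larger than the marked one form a block of some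
      length [m] next to it: the letters of this block stay above [s], and once
      a letter is at most [s] all entries further left are smaller than the
      marked one.  Hence there are [ballot m 0], a Catalan number, choices for
      the block, and [ballot r s] for the [r] entries further left
      ([extensions_above]).
    - The marked value, counted from 0, is [r + s]: every smaller entry lies
      either in the part of length [r] or among the [s] later ones.

    With [r] and [m] determined by [s] and by the marked position and value,
    summing the product of the three factors over [s] counts the permutations
    ([card_Sbullet]).  The ballot numbers have the closed form
    [(s + 1) / (k + s + 1) * 'C(2k + s, k + s)] by Pascal's rule ([ballotE]),
    and the substitution [i0 = j - s] gives the formula. *)

Local Open Scope nat_scope.

(** * Ballot numbers *)

(** The number of words of length [k] whose last letter is at most [s] and in
    which each letter exceeds the next one by at most 1; equivalently the
    coefficient of [x^k] in the power [s + 1] of the Catalan series.  The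
    recursion chooses the last letter [a], after which the preceding letter is
    at most [a + 1]. *)
Fixpoint ballot (k s : nat) : nat :=
  if k is k'.+1 then \sum_(a < s.+1) ballot k' a.+1 else 1.

Lemma ballotSS k s : ballot k.+1 s.+1 = ballot k.+1 s + ballot k s.+2.
Proof. by rewrite /= big_ord_recr. Qed.

Lemma ballotS0 k : ballot k.+1 0 = ballot k 1.
Proof. by rewrite /= big_ord_recr big_ord0. Qed.

(** The reflection form of the ballot numbers.  Both binomials obey Pascal's
    rule, which is the recursion [ballotSS]; at [s = 0] the symmetry of the
    middle binomials replaces the absent left neighbour. *)
Lemma ballot_bin k s :
  ballot k s + 'C(2 * k + s, (k + s).+1) = 'C(2 * k + s, k + s).
Proof.
elim: k s => [|k IHk] s; first by rewrite muln0 !add0n bin_small // binn.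
elim: s => [|s IHs].
  have := IHk 1; rewrite ballotS0.
  have -> : 2 * k.+1 + 0 = (2 * k + 1).+1 by lia.
  rewrite !addn0 (addn1 k) (binS _ k) (binS _ k.+1).
  have -> : 'C(2 * k + 1, k) = 'C(2 * k + 1, k.+1).
    by rewrite -[RHS]bin_sub; [congr 'C(_, _)|]; lia.
  by lia.
have := IHk s.+2; rewrite ballotSS.
have -> : 2 * k.+1 + s.+1 = (2 * k.+1 + s).+1 by lia.
have -> : 2 * k + s.+2 = 2 * k.+1 + s by lia.
have -> : k.+1 + s.+1 = (k.+1 + s).+1 by lia.
have -> : k + s.+2 = (k.+1 + s).+1 by lia.
by rewrite (binS _ (k.+1 + s)) (binS _ (k.+1 + s).+1); lia.
Qed.

Lemma ballot_mul k s :
  (k + s).+1 * ballot k s = s.+1 * 'C(2 * k + s, k + s).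
Proof.
have E := ballot_bin k s.
have := mul_bin_left (2 * k + s) (k + s).
have -> : 2 * k + s - (k + s) = k by lia.
nia.
Qed.

(** Here [ballot (t - s) s] counts the words of length [t + 1] from [s] down to
    0, and prepending [a] is possible when [a.-1 <= s]: the sum telescopes by
    [ballotSS]. *)
Lemma sum_ballot_tail t a : a <= t.+1 ->
  \sum_(a.-1 <= s < t.+1) ballot (t - s) s = ballot (t.+1 - a) a.
Proof.
move=> le_a; have [d def_t] : exists d, t.+1 = a + d by exists (t.+1 - a); lia.
elim: d a t def_t {le_a} => [|d IHd] a t def_t.
  by have -> : a = t.+1; rewrite ?subnn /= ?big_nat1 ?subnn //; lia.
case: a def_t => [|a] def_t.
  (* The letters 0 and 1 can be prepended to the same words. *)
  rewrite subn0 ballotS0 /=.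
  have := IHd 1 t; rewrite /= => ->; last by lia.
  by rewrite subn1.
rewrite /= big_ltn; last by lia.
have := IHd a.+2 t; rewrite /= => ->; last by lia.
have -> : t.+1 - a.+1 = (t - a.+1).+1 by lia.
rewrite ballotSS; congr (_ + _); congr (ballot _ _); lia.
Qed.

(** * Extending a permutation to the left *)

(** The number of ways to prepend [p] entries to a 312-avoiding permutation
    with first entry [a] so that an entry of value [u] ends up with value [v].
    Prepending [k] shifts the values that are at least [k], which is
    [bump k]. *)
Fixpoint extensions (p a u v : nat) : nat :=
  if p is p'.+1 then \sum_(k < a.+2) extensions p' k (bump k u) v else u == v.

Lemma extensions_eq0 p a u v :
  (v < u) || (u + p < v) -> extensions p a u v = 0.
Proof.
elim: p a u => [|p IHp] a u out /=; first by apply/eqP; lia.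
by apply: big1 => k _; apply: IHp; rewrite /bump; lia.
Qed.

(** When the first entry is below the marked value [u], the next one is at most
    [u] and shifts the marked value above itself; so this persists and every
    further entry adds 1 to the marked value. *)
Lemma extensions_below p a u v : a < u ->
  extensions p a u v = (u + p == v) * ballot p a.+1.
Proof.
elim: p a u => [|p IHp] a u lt_au; first by rewrite addn0 muln1.
rewrite /= big_distrr; apply: eq_bigr => k _ /=.
have -> : bump k u = u.+1 by rewrite /bump; have := ltn_ord k; lia.
by rewrite IHp ?addSnnS //; have := ltn_ord k; lia.
Qed.

(** When the first entry is [u + d], the new entries split into [m] entries
    larger than the marked one and then [r] smaller ones.  Letters of the first
    block, lowered by [u + 1], form an arbitrary word whose last letter is at
    most [d]; the other letters form a word whose last letter is at most [u]. *)
Lemma extensions_above m r d u :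
  extensions (m + r) (u + d) u (u + r) = ballot m d * ballot r u.
Proof.
have [p def_p] : exists p, p = m + r by exists (m + r).
elim: p m r d def_p => [|p IHp] m r d def_p.
  have [-> ->] : m = 0 /\ r = 0 by lia.
  by rewrite /= addn0 eqxx.
rewrite -def_p /= -(big_mkord xpredT (fun k => extensions p k (bump k u) _)).
rewrite (@big_cat_nat _ _ _ u.+1) /=; [|lia|lia].
(* If the next entry is at most [u], the block of larger entries is over. *)
have -> : \sum_(0 <= k < u.+1) extensions p k (bump k u) (u + r)
        = (m == 0) * ballot p.+1 u.
  rewrite /= -(big_mkord xpredT (fun k => ballot p k.+1)) big_distrr.
  apply: eq_big_nat => k /andP[_ le_ku] /=.
  have -> : bump k u = u.+1 by rewrite /bump; lia.
  rewrite extensions_below //; congr (nat_of_bool _ * _); lia.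
rewrite -{1}[u.+1]add0n big_addn.
have -> : (u + d).+2 - u.+1 = d.+1 by lia.
rewrite big_mkord.
case: m def_p => [|m] def_p.
  rewrite mul1n def_p add0n [ballot 0 d]/= mul1n.
  rewrite big1 ?addn0 // => x _; apply: extensions_eq0.
  by rewrite /bump; lia.
rewrite mul0n add0n /= big_distrl; apply: eq_bigr => x _ /=.
have -> : bump (x + u.+1) u = u by rewrite /bump; lia.
have -> : x + u.+1 = u + x.+1 by lia.
have -> : p = m + r by lia.
by rewrite IHp //; lia.
Qed.

(** * Peeling off the first entry of a 312-avoiding permutation *)

Lemma avoids312P n (s : {perm 'I_n}) :
  reflect (forall i1 i2 i3 : 'I_n, i1 < i2 -> i2 < i3 -> s i3 < s i1 ->
             s i2 < s i3 -> False)
          (avoids312 s).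
Proof.
apply: (iffP negP) => [av i1 i2 i3 lt12 lt23 lt31 lt_s | av].
  by apply: av; apply/existsP; exists i1; apply/existsP; exists i2;
     apply/existsP; exists i3; apply/and4P.
case/existsP=> i1 /existsP[i2 /existsP[i3 /and4P[]]]; exact: av.
Qed.

Lemma ltn_lift n (k : 'I_n.+1) (x y : 'I_n) : (lift k x < lift k y) = (x < y).
Proof. by rewrite /= /bump; lia. Qed.

(** A 312 pattern led by the new first entry [k] is an ascent pair of values
    below [k].  If [k > s 0 + 1], the values [s 0] and [s 0 + 1] are one;
    otherwise the larger value of the pair is below [s 0], so [s 0] leads a 312
    pattern within [s]. *)
Lemma avoids312_lift_perm n (k : 'I_n.+2) (s : 'S_n.+1) :
  avoids312 (lift_perm ord0 k s) = avoids312 s && (k <= (s ord0).+1).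
Proof.
apply/avoids312P/andP => [av | [/avoids312P av le_k] i1 i2 i3].
  split.
    apply/avoids312P=> i1 i2 i3 lt12 lt23 lt31 lt_s.
    by apply: (av (lift ord0 i1) (lift ord0 i2) (lift ord0 i3));
       rewrite ?lift_perm_lift ltn_lift.
  rewrite leqNgt; apply/negP=> lt_k.
  have lt_s0 : (s ord0).+1 < n.+1 by have := ltn_ord k; lia.
  pose b := (s^-1)%g (Ordinal lt_s0).
  have sb : s b = (s ord0).+1 :> nat by rewrite permKV.
  have b_gt0 : 0 < b.
    rewrite lt0n; apply/eqP=> b0.
    by have := sb; have -> : b = ord0 by [apply: val_inj]; lia.
  apply: (av ord0 (lift ord0 ord0) (lift ord0 b)) => //;
    rewrite ?lift_perm_id ?lift_perm_lift ?ltn_lift ?sb //=.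
  by rewrite sb /bump; lia.
case: (unliftP ord0 i2) => [a -> | -> //].
case: (unliftP ord0 i3) => [b -> | -> //].
case: (unliftP ord0 i1) => [c -> | ->].
  by rewrite !lift_perm_lift !ltn_lift; apply: av.
rewrite lift_perm_id !lift_perm_lift !ltn_lift => _ lt_ab lt_bk lt_s.
have le_b : s b <= s ord0 by move: lt_bk; rewrite /= /bump; lia.
have ne_b : s b != s ord0 :> nat.
  by apply/eqP=> /val_inj/perm_inj b0; rewrite b0 in lt_ab.
have ne_a : s a != s ord0 :> nat by lia.
apply: (av ord0 a b) => //; last by lia.
by rewrite lt0n; apply: contra ne_a => /eqP a0; rewrite (_ : a = ord0) //; apply: val_inj.
Qed.

Lemma lift_perm_bij n (i : 'I_n.+1) :
  bijective (fun ks : 'I_n.+1 * 'S_n => lift_perm i ks.1 ks.2).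
Proof.
apply: inj_card_bij; last by rewrite card_prod card_ord !card_Sn factS.
case=> [k s] [k' s'] /= eq_ks.
have eq_k : k = k' by rewrite -(lift_perm_id i k s) eq_ks lift_perm_id.
rewrite eq_k in eq_ks *; congr (_, _); apply/permP=> x.
by apply: (@lift_inj _ k'); rewrite -!(lift_perm_lift i) eq_ks.
Qed.

(** The new first entry is represented by a natural number, through [inord], so
    that the range of the inner sum depends on [s] only through its first
    entry. *)
Lemma sum_avoids312S n (Phi : 'S_n.+2 -> nat) :
  \sum_(s | avoids312 s) Phi s
  = \sum_(s : 'S_n.+1 | avoids312 s)
      \sum_(k < (s ord0).+2) Phi (lift_perm ord0 (inord k) s).
Proof.
rewrite (reindex _ (onW_bij _ (lift_perm_bij _ ord0))) /=.
under eq_bigl do rewrite avoids312_lift_perm andbC.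
rewrite (reindex (fun sk : 'S_n.+1 * 'I_n.+2 => (sk.2, sk.1))) /=; last first.
  by apply: onW_bij; exists (fun x => (x.2, x.1)) => -[].
under eq_bigl do rewrite andbC.
rewrite -(pair_big_dep (fun s => avoids312 s)
  (fun s (k : 'I_n.+2) => k <= (s ord0).+1)
  (fun s k => Phi (lift_perm ord0 k s))) /=.
apply: eq_bigr => s _.
rewrite (big_ord_widen n.+2 (fun k => Phi (lift_perm ord0 (inord k) s))); last first.
  by have := ltn_ord (s ord0); lia.
by apply: eq_bigr => k _; rewrite inord_val.
Qed.

(** [extensions] does count extensions: each prepended entry moves the marked
    position [q] one step to the right. *)
Lemma sum_extensions p n (q : 'I_n.+1) v :
  \sum_(s : 'S_n.+1 | avoids312 s) extensions p (s ord0) (s q) v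
  = \sum_(s : 'S_(p + n).+1 | avoids312 s) (s (inord (p + q)) == v :> nat).
Proof.
elim: p n q => [|p IHp] n q.
  by apply: eq_bigr => s _; rewrite inord_val.
have := IHp n.+1 (lift ord0 q).
have -> : p + lift ord0 q = p.+1 + q by rewrite /= /bump /=; lia.
rewrite -addSnnS => <-; rewrite sum_avoids312S.
apply: eq_bigr => s _ /=; apply: eq_bigr => k _.
by rewrite lift_perm_id lift_perm_lift /= inordK //; have := ltn_ord (s ord0); have := ltn_ord k; lia.
Qed.

(** The 312-avoiding permutations of size [t + 1] with first entry [s] are
    counted by [ballot (t - s) s]; the weighted form with an arbitrary [h] is
    what the induction on [t] needs. *)
Lemma sum_first_entry t (h : nat -> nat) :
  \sum_(s : 'S_t.+1 | avoids312 s) h (s ord0)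
  = \sum_(s < t.+1) ballot (t - s) s * h s.
Proof.
elim: t h => [|t IHt] h.
  rewrite big_ord1 (big_pred1 1%g) => [|s]; first by rewrite perm1 mul1n.
  have -> : s = 1%g by apply/permP=> i; rewrite !ord1.
  by rewrite /= eqxx; apply/avoids312P=> i1 i2; rewrite !ord1.
rewrite sum_avoids312S.
transitivity (\sum_(s : 'S_t.+1 | avoids312 s) \sum_(k < (s ord0).+2) h k).
  apply: eq_bigr => s _; apply: eq_bigr => k _.
  by rewrite lift_perm_id inordK //; have := ltn_ord (s ord0); have := ltn_ord k; lia.
rewrite (IHt (fun a => \sum_(k < a.+2) h k)).
transitivity (\sum_(s < t.+1) \sum_(k < t.+2 | k <= s.+1) ballot (t - s) s * h k).
  apply: eq_bigr => s _; rewrite big_distrr /=.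
  by rewrite (big_ord_widen t.+2 (fun k => _ * h k)) // ltnS.
rewrite (exchange_big_dep xpredT) //=; apply: eq_bigr => k _.
rewrite -sum_ballot_tail; last by have := ltn_ord k; lia.
rewrite big_distrl /= big_geq_mkord; apply: eq_bigl => s; lia.
Qed.

(** * The count at a marked position *)

(** The suffix after position [p] contributes the first factor; the [p] entries
    before it consist of [v - s] smaller and [p - v + s] larger ones. *)
Lemma card_Sbullet p t v : v <= p ->
  #|Sbullet (p + t).+1 p.+1 v.+1|
  = \sum_(s < t.+1 | s <= v)
      ballot (t - s) s * (ballot (p - v + s) 0 * ballot (v - s) s).
Proof.
move=> le_vp; rewrite -sum1_card.
transitivity (\sum_(s : 'S_(p + t).+1 | avoids312 s) (s (inord (p + 0)) == v :> nat)).
  rewrite [RHS]big_mkcond [LHS]big_mkcond; apply: eq_bigr => s _ /=.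
  rewrite inE; case: (avoids312 s) => //=; rewrite addn0.
  have Ep : inord p = p :> nat := inordK (leq_addr t p : p < (p + t).+1).
  case: existsP => [[k /andP[/eqP[kp] /eqP[skv]]] | no_k].
    by rewrite (_ : inord p = k) ?skv ?eqxx //; apply: val_inj; rewrite /= Ep.
  case: eqP => // sv; case: no_k; exists (inord p).
  by rewrite Ep sv !eqxx.
rewrite -(sum_extensions p t ord0 v) (sum_first_entry t (fun a => extensions p a a v)).
rewrite (bigID (fun s : 'I_t.+1 => s <= v)) /= [X in _ + X]big1 ?addn0 => [|s]; last first.
  by move=> lt_vs; rewrite extensions_eq0 ?muln0 //; lia.
apply: eq_bigr => s le_sv; rewrite -extensions_above; congr (_ * extensions _ _ _ _); lia.
Qed.

Local Open Scope ring_scope.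

(** * The closed formula *)

Lemma ballotE k s :
  (ballot k s)%:R
  = s.+1%:R / (k + s).+1%:R * ('C(2 * k + s, k + s))%:R :> rat.
Proof.
have nz : (k + s).+1%:R != 0 :> rat by rewrite Num.Theory.pnatr_eq0.
apply: (mulfI nz); rewrite -natrM ballot_mul natrM.
by rewrite mulrA mulrCA mulfV // mulr1.
Qed.

Lemma ballot0_catalan m : (ballot m 0)%:R = catalan m.
Proof. by rewrite ballotE /catalan !addn0 mul1r. Qed.

Theorem theorem2p3 (N j t : nat) (hN : (1 <= N)%N) (hj : (1 <= j)%N)
    (ht : (t < N)%N) (hjt : (j < N - t)%N) :
  #|Sbullet N (N - t) j|%:R =
  \sum_(maxn 1 (j - t) <= i0 < j.+1)
     catalan (N - t - i0)
     * ((j%:R - i0%:R + 1) ^+ 2 / (j%:R * (t%:R + 1)))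
     * ('C(i0 + 2 * t - j, t))%:R * ('C(i0 + j - 2, j - 1))%:R :> rat.
Proof.
case: j hj hjt => // v _ hjt.
have [p def_N] : exists p, N = (p + t).+1 by exists (N - t.+1)%N; lia.
have -> : (N - t = p.+1)%N by lia.
have le_vp : (v <= p)%N by lia.
rewrite def_N card_Sbullet // natr_sum.
(* The summation index becomes [s = j - i0]. *)
rewrite big_geq_mkord [RHS](reindex_inj rev_ord_inj) /=.
transitivity (\sum_(s < v.+2 | (s <= v)%N && (s < t.+1)%N)
  (ballot (t - s) s * (ballot (p - v + s) 0 * ballot (v - s) s))%:R : rat).
  pose F s := (ballot (t - s) s * (ballot (p - v + s) 0 * ballot (v - s) s))%:R : rat.
  rewrite -(big_mkord (fun s => s <= v)%N F).
  rewrite -(big_mkord (fun s => (s <= v) && (s < t.+1))%N F).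
  rewrite (big_nat_widen _ _ (v.+2 + t.+1)) ?leq_addl //.
  rewrite [RHS](big_nat_widen _ _ (v.+2 + t.+1)) ?leq_addr //.
  apply: eq_bigl => s; lia.
apply: eq_big => [s | s /andP[le_sv le_st]]; first by have := ltn_ord s; lia.
rewrite !natrM ballot0_catalan !ballotE.
have -> : (p.+1 - (v.+2 - s.+1) = p - v + s)%N by lia.
have -> : (v.+2 - s.+1 + 2 * t - v.+1 = 2 * (t - s) + s)%N by lia.
have -> : (v.+2 - s.+1 + v.+1 - 2 = 2 * (v - s) + s)%N by lia.
have -> : (t - s + s = t)%N by lia.
have -> : (v - s + s = v)%N by lia.
have -> : (v.+1 - 1 = v)%N by lia.
have -> : v.+1%:R - (v.+2 - s.+1)%:R + 1 = s.+1%:R :> rat.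
  by rewrite -natrB; [rewrite natr1; congr (_%:R) | ]; lia.
rewrite natr1; field.
by rewrite !nat1r !Num.Theory.pnatr_eq0.
Qed.
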